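(* Let $G$ be a finite group with $M$ elements and identity $1$ such that $g\circ g=1$ for every $g\in G$, and let $\lambda$ be the uniform probability measure on the set $G^G$ of all maps $\varphi:G\to G$. Then for every fixed integer $k\ge 0$, $$\lim_{M\to\infty}\lambda\left(|\ker\varphi|=k\right)=\frac{1}{e\,k!}.$$
   Context: For an arbitrary map $\varphi:G\to G$ (not necessarily a homomorphism), $\ker\varphi=\{g\in G:\varphi(g)=1\}$. The limit is taken along the orders $M$ of such groups $G$. *)

(* Defs.v *)
From mathcomp Require Import all_boot all_algebra all_fingroup.
From mathcomp Require Import reals.

Set Implicit Arguments.
Unset Strict Implicit.
Unset Printing Implicit Defensive.

Import GRing.Theory.

Local Open Scope ring_scope.

(* The library's 'ker is reserved for morphisms; here phi is any map. *)
Definition map_ker (gT : finGroupType) (phi : {ffun gT -> gT}) : {set gT} :=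
  [set g | phi g == 1%g].

Definition uniform_measure (R : realType) (T : finType) (A : {set T}) : R :=
  #|A|%:R / #|T|%:R.

(* Main.v *)
Require Import Defs.
From mathcomp Require Import all_boot all_order all_algebra all_fingroup.
From mathcomp Require Import all_classical all_reals all_analysis.

Import Order.TTheory GRing.Theory Num.Theory.
Import numFieldNormedType.Exports.

Local Open Scope classical_set_scope.
Local Open Scope ring_scope.

(** The kernel of a map is its fiber over [1], and the values of a uniformly
    random map are independent and uniform.  A map whose fiber over a given
    point is the set [S] is an arbitrary choice of one of the [M - 1] other
    values at each point outside [S]; summing over the sets [S] of size [k]
    gives ['C(M, k) * (M - 1) ^ (M - k)] favourable maps among [M ^ M].  The
    fiber size is thus binomial with parameters [M] and [1 / M]
    ([prob_fiber]), and it converges to the Poisson law of rate 1: once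
    [M >= k] the probability factors as

      [(M ^_ k / M ^ k) / k! * (1 - 1/M) ^ M / (1 - 1/M) ^ k],

    where, for fixed [k], both [M ^_ k / M ^ k] ([cvg_ffact_div_expn]) and
    [(1 - 1/M) ^ k] tend to 1, while [(1 - 1/M) ^ M] tends to [1 / e]
    ([cvg_expR_N1]). *)

(** The fiber over [y] is the complement of the [y]-support, which turns such
    maps into partial functions on [~: S] with values other than [y]. *)
Lemma card_ffun_fiber (aT rT : finType) (y : rT) (S : {set aT}) :
  #|[set f : {ffun aT -> rT} | [set x | f x == y]%SET == S]%SET|
    = (#|rT|.-1 ^ (#|aT| - #|S|))%N.
Proof.
rewrite -(cardsC S) addKn -(cardC1 y) -(card_pffun_on y).
apply: eq_card => f; rewrite inE.
apply/eqP/pffun_onP => [fS | [/supportP fS f_y]].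
  rewrite -fS; split=> [|z /mapP[x]]; last by rewrite mem_enum !inE => fx ->.
  by apply/fintype.subsetP => x; rewrite !inE.
apply/setP => x; rewrite inE; have [xS|xS] := boolP (x \in S).
  by rewrite fS ?eqxx // !inE xS.
apply/negbTE; have /[!inE] := f_y (f x); apply.
by apply: fintype.image_f; rewrite inE.
Qed.

Lemma card_ffun_card_fiber (aT rT : finType) (y : rT) (k : nat) :
  #|[set f : {ffun aT -> rT} | #|[set x | f x == y]%SET| == k]%SET|
    = ('C(#|aT|, k) * #|rT|.-1 ^ (#|aT| - k))%N.
Proof.
rewrite -sum1dep_card.
rewrite (partition_big (fun f : {ffun aT -> rT} => [set x | f x == y]%SET)
  (fun S : {set aT} => #|S| == k)) //=.
under eq_bigr => S /eqP Sk.
  rewrite (eq_bigl (fun f : {ffun aT -> rT} => [set x | f x == y]%SET == S)).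
    rewrite sum1dep_card card_ffun_fiber Sk; over.
  by move=> f /=; apply: andb_idl => /eqP ->; rewrite Sk.
by rewrite sum_nat_cond_const -card_draws cardsE.
Qed.

(** The binomial law with parameters [M] and [1 / M]. *)
Lemma prob_fiber (R : realType) (T : finType) (y : T) (k : nat) :
  uniform_measure R [set f : {ffun T -> T} | #|[set x | f x == y]%SET| == k]%SET
    = 'C(#|T|, k)%:R * #|T|%:R ^- k * (1 - #|T|%:R^-1) ^+ (#|T| - k).
Proof.
rewrite /uniform_measure card_ffun_card_fiber card_ffun.
have [Tk|kT] := ltnP #|T| k; first by rewrite bin_small // !mul0r.
have T_gt0 : (0 < #|T|)%N by apply/card_gt0P; exists y.
have T_neq0 : #|T|%:R != 0 :> R by rewrite pnatr_eq0 -lt0n.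
have -> : 1 - #|T|%:R^-1 = #|T|.-1%:R / #|T|%:R :> R.
  by rewrite -subn1 natrB // mulrBl divff // mul1r.
have powE : #|T|%:R ^+ #|T| = #|T|%:R ^+ k * #|T|%:R ^+ (#|T| - k) :> R.
  by rewrite -exprD subnKC.
by rewrite natrM !natrX powE expr_div_n invfM mulrACA.
Qed.

Lemma cvg_invn (R : realType) : (n%:R^-1 : R) @[n --> \oo] --> (0 : R).
Proof. by rewrite -cvg_shiftS; exact: cvg_harmonic. Qed.

(** With [k] fixed, each of the [k] factors [n - i] of [n ^_ k] is
    asymptotic to [n]. *)
Lemma cvg_ffact_div_expn (R : realType) (k : nat) :
  ((n ^_ k)%:R / n%:R ^+ k : R) @[n --> \oo] --> (1 : R).
Proof.
elim: k => [|k IHk].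
  by under eq_cvg do rewrite ffactn0 expr0 divr1; exact: cvg_cst.
have lim1 : (1 - k%:R * n%:R^-1 : R) @[n --> \oo] --> (1 : R).
  rewrite -[X in _ --> X]subr0 -(mulr0 k%:R).
  by apply: cvgB; [exact: cvg_cst|apply: cvgM; [exact: cvg_cst|exact: cvg_invn]].
rewrite -[X in _ --> X]mulr1.
apply: cvg_trans (cvgM IHk lim1); apply: near_eq_cvg; near=> n.
have kn : (k < n)%N by near: n; exact: nbhs_infty_gt.
have n_neq0 : n%:R != 0 :> R by rewrite pnatr_eq0 -lt0n (leq_ltn_trans _ kn).
rewrite /= ffactnSr natrM exprSr invfM mulrACA natrB 1?ltnW //.
by rewrite mulrBl divff.
Unshelve. all: by end_near. Qed.

(** The squeeze uses [1 + x <= expR x] twice: taken at [- 1/n] it gives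
    [(1 - 1/n) ^ n <= expR (- 1)], and taken at [1/(n - 1)], since
    [(1 - 1/n)^-1 = 1 + 1/(n - 1)], it gives
    [expR (- (1 + 1/(n - 1))) <= (1 - 1/n) ^ n]. *)
Lemma cvg_expR_N1 (R : realType) :
  ((1 - n%:R^-1) ^+ n : R) @[n --> \oo] --> (expR (- 1) : R).
Proof.
rewrite -(@cvg_shiftn 2).
pose h n : R := n.+1%:R^-1.
have lim_lo : (expR (- (1 + h n)) : R) @[n --> \oo] --> (expR (- 1) : R).
  apply: (@cvg_comp _ _ _ (fun n => - (1 + h n)) expR _ (nbhs (- 1 : R))).
    apply: cvgN; rewrite -[X in _ --> X]addr0.
    by apply: cvgD; [exact: cvg_cst|exact: cvg_harmonic].
  exact: continuous_expR.
apply: (squeeze_cvgr _ lim_lo (cvg_cst _)).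
apply: nearW => n; rewrite /= addn2.
have h_gt0 : 0 < h n by rewrite /h invr_gt0.
have h_mul : h n * n.+2%:R = 1 + h n.
  by rewrite -[n.+2]addn1 natrD mulrDr mulr1 mulVf // pnatr_eq0.
have inv_h : 1 - n.+2%:R^-1 = (1 + h n)^-1.
  rewrite -h_mul invfM invrK -[n.+1%:R](addrK 1) natr1.
  by rewrite mulrBl divff ?mul1r // pnatr_eq0.
apply/andP; split.
  rewrite -h_mul -mulNr expRM_natr lerXn2r ?nnegrE ?expR_ge0 //.
    by rewrite inv_h invr_ge0 addr_ge0 // ltW.
  rewrite inv_h expRN lef_pV2 ?posrE ?expR_gt0 ?expR_ge1Dx //.
  by rewrite addr_gt0.
have -> : expR (- 1) = expR (- n.+2%:R^-1) ^+ n.+2 :> R.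
  by rewrite -expRM_natr mulNr mulVf // pnatr_eq0.
rewrite lerXn2r ?nnegrE ?expR_ge0 ?expR_ge1Dx //.
by rewrite inv_h invr_ge0 addr_ge0 // ltW.
Qed.

(** Poisson limit of the binomial laws with parameters [n] and [1 / n]. *)
Lemma cvg_binomial_poisson (R : realType) (k : nat) :
  ('C(n, k)%:R * n%:R ^- k * (1 - n%:R^-1) ^+ (n - k) : R) @[n --> \oo]
    --> (1 / (expR 1 * k`!%:R) : R).
Proof.
have lim_1 : (1 - n%:R^-1 : R) @[n --> \oo] --> (1 : R).
  rewrite -[X in _ --> X]subr0.
  by apply: cvgB; [exact: cvg_cst|exact: cvg_invn].
have lim_base : ((1 - n%:R^-1) ^+ k : R) @[n --> \oo] --> (1 : R).
  rewrite -[X in _ --> X](expr1n _ k).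
  apply: (@cvg_comp _ _ _ (fun n => 1 - n%:R^-1 : R) (fun x => x ^+ k) _
    (nbhs (1 : R)) _ lim_1).
  exact: exprn_continuous.
have lim : ((n ^_ k)%:R / n%:R ^+ k / k`!%:R
    * ((1 - n%:R^-1) ^+ n * (1 - n%:R^-1) ^- k) : R) @[n --> \oo]
    --> (1 / k`!%:R * (expR (- 1) * 1^-1) : R).
  apply: cvgM.
    by apply: cvgM; [exact: cvg_ffact_div_expn|exact: cvg_cst].
  by apply: cvgM; [exact: cvg_expR_N1|apply: cvgV; rewrite ?oner_neq0].
have -> : 1 / (expR 1 * k`!%:R) = 1 / k`!%:R * (expR (- 1) * 1^-1) :> R.
  by rewrite expRN invr1 mulr1 !mul1r invfM mulrC.
apply: cvg_trans lim; apply: near_eq_cvg; near=> n.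
have n_gt1 : (1 < n)%N by near: n; exact: nbhs_infty_gt.
have kn : (k <= n)%N by near: n; exact: nbhs_infty_ge.
have base_neq0 : 1 - n%:R^-1 != 0 :> R.
  by rewrite subr_eq0 eq_sym invr_eq1 pnatr_eq1 gtn_eqF.
have fact_neq0 : k`!%:R != 0 :> R by rewrite pnatr_eq0 -lt0n fact_gt0.
rewrite -bin_ffact natrM [_ / _ / k`!%:R]mulrAC mulfK //.
have -> : (1 - n%:R^-1) ^+ n = (1 - n%:R^-1) ^+ (n - k) * (1 - n%:R^-1) ^+ k :> R.
  by rewrite -exprD subnK.
by rewrite mulfK ?expf_neq0.
Unshelve. all: by end_near. Qed.

(* The probability a priori depends on G and not only on its order M, so the
   limit is written out: for every eps > 0 and all large M, every such group
   of order M satisfies the estimate.  A filter on the type of all finite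
   groups is excluded by universe constraints. *)
Theorem theorem4p1 (R : realType) (k : nat) :
  forall eps : R, 0 < eps ->
  \forall M \near \oo,
  forall G : finGroupType,
    #|G| = M ->
    (forall g : G, (g * g)%g = 1%g) ->
    `| uniform_measure R [set phi : {ffun G -> G} | #|map_ker phi| == k]%SET
       - 1 / (expR 1 * k`!%:R) | < eps.
Proof.
move=> eps eps_gt0; near=> M => G GM _.
rewrite /map_ker prob_fiber GM //.
near: M; exact: cvgr_distC_lt (cvg_binomial_poisson R k) eps eps_gt0.
Unshelve. all: by end_near. Qed.
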